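(* If $Q\ge4$, then there is a point $(x_1,x_3,x_4)\in G$ with $x_3>0$ such that $$ \mathcal B(x_1,x_3,x_4)\ \ge\ \frac1{515}\,Q(\log Q)^{1/3}\,x_3 . $$
   Context: Let $I=[0,1]$, $\mathcal D(I)$ its dyadic subintervals, and $h_J$ the Haar function equal to $|J|^{-1/2}$ on the right half of $J$, $-|J|^{-1/2}$ on the left half, $0$ off $J$. $\langle f\rangle_I=\frac1{|I|}\int_I f$, $w(S)=\int_S w\,dt$. A weight $w>0$ on $I$ has $[w]_{A_1}=\sup_{J\in\mathcal D(I)}\langle w\rangle_J/\inf_J w$ (essential infimum). Fix $Q$. Let $\Omega=\{x\in\mathbb R^5: x_3\ge|x_1|x_5,\ 0<x_5\le x_4\le Qx_5\}$. For $x\in\Omega$, a triple $(\varphi,\psi,w)$ on $I$ is admissible for $x$ if $\varphi=x_1+\sum_{J\in\mathcal D(I)}(\varphi,h_J)h_J$, $\psi=x_2+\sum_{J\in\mathcal D(I)}\varepsilon_J(\varphi,h_J)h_J$ with $|\varepsilon_J|\le1$ (the sums having a finite, unspecified number of terms), $w$ is a weight with $[w]_{A_1}\le Q$, and $\langle|\varphi|w\rangle_I=x_3$, $\langle w\rangle_I=x_4$, $\inf_I w=x_5$. The Bellman function is $\mathbf B(x)=\sup\frac1{|I|}w(\{t\in I:\psi(t)\ge0\})$, the supremum over all triples admissible for $x$. Finally $G=\{(x_1,x_3,x_4)\in\mathbb R^3:|x_1|\le x_3,\ 1\le x_4\le Q\}$ and $\mathcal B(x_1,x_3,x_4)=\mathbf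 B(x_1,-1,x_3,x_4,1)$ for $(x_1,x_3,x_4)\in G$. $\log$ is the natural logarithm. *)

(* Defs.v *)
From mathcomp Require Import all_boot all_order all_algebra.
From mathcomp Require Import finmap all_classical all_reals all_analysis.
From mathcomp Require Import ess_sup_inf.

Set Implicit Arguments.
Unset Strict Implicit.
Unset Printing Implicit Defensive.

Import Order.TTheory GRing.Theory Num.Theory.
Import numFieldNormedType.Exports.

Local Open Scope classical_set_scope.
Local Open Scope fset_scope.
Local Open Scope ring_scope.

(* Index (n, k), k < 2 ^ n, of the dyadic interval [k / 2^n, (k + 1) / 2^n[
   of [0, 1].  Dyadic intervals and their halves are taken half-open, so that
   every pointwise identity below is unambiguous; this affects null sets only. *)
Definition dyadic : Type := {n : nat & 'I_(2 ^ n)}.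

Section BellmanA1.
Context {R : realType}.
Implicit Types (J : dyadic) (f phi psi w : R -> R) (Q : R).

Notation mu := (@lebesgue_measure R).

Definition unitI : set R := `[0, 1].

Definition dyadic_left J : R := (tagged J)%:R / 2 ^+ tag J.

Definition dyadic_length J : R := (2 ^+ tag J)^-1.

Definition dyadic_mid J : R := dyadic_left J + dyadic_length J / 2.

Definition dyadic_right J : R := dyadic_left J + dyadic_length J.

Definition dyadic_itv J : set R := `[dyadic_left J, dyadic_right J[.

Definition haar J (t : R) : R :=
  (Num.sqrt (dyadic_length J))^-1 *
  (\1_(`[dyadic_mid J, dyadic_right J[) t
   - \1_(`[dyadic_left J, dyadic_mid J[) t).

Definition haar_coef f J : R := \int[mu]_(t in unitI) (f t * haar J t).

Definition wmeasure w (S : set R) : \bar R := (\int[mu]_(t in S) (w t)%:E)%E.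

Definition average f (A : set R) : \bar R :=
  ((\int[mu]_(t in A) (f t)%:E) / mu A)%E.

(* Essential infimum over A: the function is set to +oo off A, which does not
   contribute. *)
Definition ess_inf_on (A : set R) f : \bar R :=
  ess_inf mu (patch (cst +oo%E) A (EFin \o f)).

Definition weight w : Prop :=
  mu.-integrable unitI (EFin \o w) /\ (forall t, unitI t -> 0 < w t).

(* For extended reals, 0^-1 = +oo. *)
Definition A1_char w : \bar R :=
  ereal_sup [set (average w (dyadic_itv J)
                  / ess_inf_on (dyadic_itv J) w)%E | J in [set: dyadic]].

(* The finite set F carries the terms of both Haar sums. *)
Definition martingale_pair (x1 x2 : R) phi psi : Prop :=
  exists (F : {fset dyadic}) (eps : dyadic -> R),
    [/\ forall J, `|eps J| <= 1,
        forall t, unitI t ->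
          phi t = x1 + \sum_(J <- F) haar_coef phi J * haar J t
      & forall t, unitI t ->
          psi t = x2 + \sum_(J <- F) eps J * haar_coef phi J * haar J t].

Definition Omega Q : set (R * R * R * R * R) :=
  [set x | let: (x1, x2, x3, x4, x5) := x in
           [/\ `|x1| * x5 <= x3, 0 < x5, x5 <= x4 & x4 <= Q * x5]].

Definition admissible Q (x : R * R * R * R * R) phi psi w : Prop :=
  let: (x1, x2, x3, x4, x5) := x in
  [/\ martingale_pair x1 x2 phi psi,
      weight w /\ (A1_char w <= Q%:E)%E,
      average (fun t => `|phi t| * w t) unitI = x3%:E,
      average w unitI = x4%:E
    & ess_inf_on unitI w = x5%:E].

(* Meant for x in Omega Q. *)
Definition bellman Q (x : R * R * R * R * R) : \bar R :=
  ereal_sup [set r | exists phi psi w, admissible Q x phi psi w /\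
    r = (wmeasure w (unitI `&` [set t | (0 <= psi t)%R]) / mu unitI)%E].

Definition G Q : set (R * R * R) :=
  [set y | let: (x1, x3, x4) := y in [/\ `|x1| <= x3, 1 <= x4 & x4 <= Q]].

Definition bellmanG Q (y : R * R * R) : \bar R :=
  let: (x1, x3, x4) := y in bellman Q (x1, -1, x3, x4, 1).

Lemma G_Omega Q (x1 x3 x4 : R) : G Q (x1, x3, x4) -> Omega Q (x1, -1, x3, x4, 1).
Proof. by case=> ? ? ?; split; rewrite ?mulr1. Qed.

End BellmanA1.

(* Main.v *)
Require Import Defs.
From mathcomp Require Import all_boot all_order all_algebra.
From mathcomp Require Import all_classical all_reals all_analysis.
From mathcomp Require Import finmap measurable_realfun ess_sup_inf ring lra.

Import Order.TTheory GRing.Theory Num.Theory.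
Local Open Scope classical_set_scope.
Local Open Scope ring_scope.

(** An admissible triple is exhibited whose ratio between the captured weight
    and the cost [<|phi| w>] is at least of order [Q n], for any [n > 0] with
    [4 ^ n <= 3 Q].  Choosing [n] comparable to the cube root of [ln Q] is
    allowed, and then the constants leave room to spare.

    A triple is described by a finite binary tree: an inner node splits an
    interval into its halves and moves [phi] and [psi] there by [-a, -b] and
    [+a, +b] with [|b| <= |a|]; a leaf carries a constant weight.  The cost, the
    captured weight and the [A_1] condition are then finite recursions.  By
    homogeneity, a tree that starts at [phi = 0], [psi = -1] with essential
    infimum 1 can be transplanted to [phi = 0], [psi = -d], after multiplying
    the weight by [s]: the cost is multiplied by [d s], the captured weight
    by [s].

    The heart is [strategy_boost], which turns such a tree [T] of cost [c] and
    captured weight [g] into one of cost at most [u + c (1 - n u / 2)] and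
    captured weight at least [g (1 - 2 u)], where [u = 4 ^ - n].  First [phi] is
    split into [-u] and [u].  From then on [|phi|] doubles or returns to 0.  It
    climbs to [4 ^ i u] with probability [4 ^ - i], and when it drops to 0 at
    once from there, [psi] has come closer to 0 by at least [4 ^ i u]; there a
    copy of [T] is started, scaled by at most [1 - 4 ^ i u] and thus cheaper.
    Where [phi] does not return in this way the weight is 1, so that the cost
    spent there is only [E|phi| = u], and the ambient weight is pushed into the
    copies of [T], so almost none of it is lost.  Each of the [n] levels saves the
    same amount, of order [c u]: the savings [4 ^ i u] grow as fast as the
    probabilities [4 ^ - i] decay.  This is the source of the logarithm: [n u / 2]
    is the total relative saving bought at the price [u].

    The cost map contracts to its fixed point [2 / n].  Iterating [1 / u]
    times from the elementary tree of [strategy_start] brings the cost down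
    to [4 / n] and keeps a fixed fraction of the captured weight, which is of
    order [Q] ([strategy_log]).  Finally [tree_admissible] turns a tree into
    functions on the unit interval; the Haar coefficients come out of the means of
    [phi] and [psi] on dyadic intervals. *)

Set Implicit Arguments.
Unset Strict Implicit.

(** * Trees of martingale moves *)

Section Trees.
Context {R : realType}.
Implicit Types (a b c d g p q u w x y Q : R).

(** [Node a b l r]: the left half [l] sees [phi - a] and [psi - b], the right half
    [r] sees [phi + a] and [psi + b].  The starting values of [phi] and [psi] are
    not stored, so that one tree can be started from several places. *)
Inductive tree : Type := Leaf of R | Node of R & R & tree & tree.
Implicit Types t l r T : tree.

Fixpoint mass t : R :=
  match t with
  | Leaf w => w
  | Node _ _ l r => (mass l + mass r) / 2
  end.

Fixpoint wmin t : R :=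
  match t with
  | Leaf w => w
  | Node _ _ l r => Num.min (wmin l) (wmin r)
  end.

Fixpoint cost p t : R :=
  match t with
  | Leaf w => `|p| * w
  | Node a _ l r => (cost (p - a) l + cost (p + a) r) / 2
  end.

Fixpoint gain q t : R :=
  match t with
  | Leaf w => if 0 <= q then w else 0
  | Node _ b l r => (gain (q - b) l + gain (q + b) r) / 2
  end.

(** The [A_1] bound is asked at inner nodes only: below a leaf the weight is
    constant. *)
Fixpoint A1_tree Q t : Prop :=
  match t with
  | Leaf w => 0 < w
  | Node a b l r =>
    [/\ `|b| <= `|a|, mass t <= Q * wmin t, A1_tree Q l & A1_tree Q r]
  end.

Lemma wmin_gt0 Q t : A1_tree Q t -> 0 < wmin t.
Proof.
by elim: t => //= a b l IHl r IHr [_ _ /IHl ? /IHr ?]; rewrite lt_min; apply/andP.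
Qed.

Lemma wmin_le_mass t : wmin t <= mass t.
Proof.
elim: t => //= a b l IHl r IHr.
have : Num.min (wmin l) (wmin r) <= wmin l by rewrite ge_min lexx.
have : Num.min (wmin l) (wmin r) <= wmin r by rewrite ge_min lexx orbT.
by lra.
Qed.

Lemma mass_le Q t : 1 <= Q -> A1_tree Q t -> mass t <= Q * wmin t.
Proof. by move=> Q1; case: t => [w /=|a b l r []//]; nra. Qed.

Lemma cost_ge0 Q t p : A1_tree Q t -> 0 <= cost p t.
Proof.
elim: t p => [w|a b l IHl r IHr] p /= => [w0|[_ _ gl gr]].
  by rewrite mulr_ge0// ltW.
by have := IHl (p - a) gl; have := IHr (p + a) gr; lra.
Qed.

Lemma gain_ge0 Q t q : A1_tree Q t -> 0 <= gain q t.
Proof.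
elim: t q => [w|a b l IHl r IHr] q /= => [w0|[_ _ gl gr]].
  by case: ifP => // _; exact: ltW.
by have := IHl (q - b) gl; have := IHr (q + b) gr; lra.
Qed.

Fixpoint scale d s t : tree :=
  match t with
  | Leaf w => Leaf (s * w)
  | Node a b l r => Node (d * a) (d * b) (scale d s l) (scale d s r)
  end.

Lemma mass_scale d s t : mass (scale d s t) = s * mass t.
Proof. by elim: t => //= a b l -> r ->; ring. Qed.

Lemma wmin_scale d s t : 0 < s -> wmin (scale d s t) = s * wmin t.
Proof. by move=> s0; elim: t => //= a b l -> r ->; rewrite minr_pMr// ltW. Qed.

Lemma cost_scale d s t p : 0 <= d ->
  cost (d * p) (scale d s t) = d * s * cost p t.
Proof.
move=> d0; elim: t p => [w|a b l IHl r IHr] p /=.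
  by rewrite normrM (ger0_norm d0); ring.
by rewrite -mulrBr -mulrDr IHl IHr; ring.
Qed.

Lemma gain_scale d s t q : 0 < d -> gain (d * q) (scale d s t) = s * gain q t.
Proof.
move=> d0; elim: t q => [w|a b l IHl r IHr] q /=.
  by rewrite pmulr_rge0//; case: ifP => // _; rewrite mulr0.
by rewrite -mulrBr -mulrDr IHl IHr; ring.
Qed.

Lemma A1_scale Q d s t : 0 < s -> A1_tree Q t -> A1_tree Q (scale d s t).
Proof.
move=> s0; elim: t => [w /=|a b l IHl r IHr [ba mQ gl gr]]; first exact: mulr_gt0.
split; [|  | exact: IHl | exact: IHr].
  by rewrite !normrM ler_wpM2l.
have : mass (scale d s (Node a b l r)) <= Q * wmin (scale d s (Node a b l r)).
  by rewrite mass_scale wmin_scale// [leRHS]mulrCA ler_pM2l.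
by [].
Qed.

(** * Boosting a tree *)

(** The climb of [phi = z x], where [z] is a sign, with [psi = - d].  A first
    split sends [phi] either back to 0, where [psi = - (d - x)] and a copy of [T]
    starts, or to [2 z x], where [psi = - (d + x)]; a second split undoes that
    increase of the distance while [phi] goes to [4 z x], the other half being
    abandoned with weight 1.  On the whole [x] is multiplied by 4 and the
    distance has dropped by [x]. *)
Fixpoint chain (z s : R) T (m : nat) x d : tree :=
  if m is m'.+1 then
    Node (z * x) (- x) (scale (d - x) s T)
      (Node (z * (2 * x)) (2 * x) (Leaf 1) (chain z s T m' (4 * x) (d - x)))
  else Leaf 1.

(** The bound on [s] is the largest for which the mean [Q] reproduces itself
    along the climb: [Q] is the mean of [s mass T] with weight 1/2, of 1 with
    weight 1/4 and of [Q] with weight 1/4. *)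
Lemma mass_chain Q z s T m x d : 1 <= Q -> s * mass T <= (3 * Q - 1) / 2 ->
  mass (chain z s T m x d) <= Q.
Proof.
move=> Q1 sQ; elim: m x d => [//|m IHm] x d /=.
by rewrite mass_scale; have := IHm (4 * x) (d - x); lra.
Qed.

Lemma wmin_chain z s T m x d : 1 <= s -> wmin T = 1 ->
  wmin (chain z s T m x d) = 1.
Proof.
move=> s1 T1; elim: m x d => [//|m IHm] x d /=.
rewrite IHm wmin_scale ?T1; last exact: lt_le_trans s1.
by rewrite mulr1 minxx; apply/min_idPr.
Qed.

Lemma A1_chain Q z s T m x d : `|z| = 1 -> 1 <= Q -> 1 <= s ->
  s * mass T <= (3 * Q - 1) / 2 -> wmin T = 1 -> A1_tree Q T ->
  A1_tree Q (chain z s T m x d).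
Proof.
move=> z1 Q1 s1 sQ T1 gT; have s0 : 0 < s by exact: lt_le_trans s1.
elim: m x d => [|m IHm] x d; first exact: ltr01.
split; first by rewrite [leRHS]normrM z1 mul1r normrN.
- change (mass (chain z s T m.+1 x d) <= Q * wmin (chain z s T m.+1 x d)).
  by rewrite wmin_chain// mulr1; exact: mass_chain.
- exact: A1_scale.
split; [by rewrite [leRHS]normrM z1 mul1r| |exact: ltr01|exact: IHm].
rewrite /= wmin_chain// minxx.
by have := @mass_chain Q z s T m (4 * x) (d - x) Q1 sQ; lra.
Qed.

(** The distance never runs out: along [m] steps it drops by
    [x (1 + 4 + ... + 4 ^ (m - 1)) = x (4 ^ m - 1) / 3]. *)
Lemma chain_step_dist (m : nat) x d : 0 < x -> x * (4 ^+ m.+1 - 1) < 3 * d ->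
  0 < d - x /\ 4 * x * (4 ^+ m - 1) < 3 * (d - x).
Proof.
rewrite exprS => x0 xd; have : 1 <= 4 ^+ m :> R by rewrite exprn_ege1//; lra.
by move=> m1; split; nra.
Qed.

(** The term [x] is the mean of [|phi|], paid where the weight is 1.  The
    copies of [T] have total weight [s / 2 (1 + 1/4 + ...) <= 2 s / 3], and each of
    the [m] levels saves at least [x / 2] in the last factor, since its smaller
    probability is offset by the larger drop of the distance. *)
Lemma cost_chain Q z s T m x d : `|z| = 1 -> 0 <= s -> A1_tree Q T ->
  0 < x -> x * (4 ^+ m - 1) < 3 * d ->
  x <= cost (z * x) (chain z s T m x d) <=
    x + s * cost 0 T * (2 / 3 * d - m%:R / 2 * x).
Proof.
move=> z1 s0 gT; elim: m x d => [|m IHm] x d x0 xd.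
  rewrite /= normrM z1 !mul1r mulr1 gtr0_norm// lexx/=.
  have c0 : 0 <= cost 0 T by exact: cost_ge0 gT.
  by rewrite lerDl mulr_ge0// ?mulr_ge0//; move: xd; rewrite expr0; lra.
have [dx0 xd'] := chain_step_dist x0 xd.
have /IHm/(_ xd') : 0 < 4 * x by lra.
rewrite /= subrr -[X in cost X (scale _ _ _)](mulr0 (d - x)).
rewrite (cost_scale _ _ _ (ltW dx0)).
have -> : z * x + z * x - z * (2 * x) = 0 by ring.
have -> : z * x + z * x + z * (2 * x) = z * (4 * x) by ring.
rewrite normr0 mul0r add0r -[m.+1]addn1 natrD.
have sc0 : 0 <= s * cost 0 T by rewrite mulr_ge0//; exact: cost_ge0 gT.
set C := cost _ (chain _ _ _ _ _ _).
have -> : (d - x) * s * cost 0 T = (s * cost 0 T) * (d - x) by ring.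
move: (s * cost 0 T) sc0 => e e0 /andP[C1 C2].
have ex0 : 0 <= e * x by rewrite mulr_ge0// ltW.
have ed0 : 0 <= e * (d - x) by rewrite mulr_ge0// ltW.
by apply/andP; split; lra.
Qed.

(** Only the copies of [T] are counted; they are started with total probability
    [1/2 (1 + 1/4 + ... + 1/4 ^ (m - 1)) = 2/3 (1 - 4 ^ - m)]. *)
Lemma gain_chain Q z s T m x d : 0 <= s -> A1_tree Q T ->
  0 < x -> x * (4 ^+ m - 1) < 3 * d ->
  2 / 3 * s * (1 - (4 ^+ m)^-1) * gain (-1) T <= gain (- d) (chain z s T m x d).
Proof.
move=> s0 gT; elim: m x d => [|m IHm] x d x0 xd.
  by rewrite expr0 invr1 subrr mulr0 mul0r; apply: (@gain_ge0 Q); exact: ltr01.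
have [dx0 xd'] := chain_step_dist x0 xd.
have /IHm/(_ xd') : 0 < 4 * x by lra.
rewrite /=; have -> : - d - - x = (d - x) * -1 by ring.
rewrite gain_scale//; have -> : - d + - x + 2 * x = - (d - x) by ring.
have := @gain_ge0 Q (Leaf 1) (- d + - x - 2 * x) ltr01; rewrite /=.
rewrite exprS invfM; move: (4 ^+ m)^-1 (gain (-1) T) => P G.
by set C := gain _ (chain _ _ _ _ _ _); set L := if _ then _ else _; lra.
Qed.

(** The root leaves [psi] unchanged, so that both signs of [phi] climb
    symmetrically and neither half of the weight is wasted. *)
Definition boost s u T (n : nat) : tree :=
  Node u 0 (chain (-1) s T n u 1) (chain 1 s T n u 1).

(** [T] is meant to be started at [phi = 0], [psi = -1]. *)
Definition strategy Q c g T : Prop :=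
  [/\ A1_tree Q T, wmin T = 1, 0 < cost 0 T <= c & g <= gain (-1) T].

(** With [s = 3/2 - 1/(2 Q)], the largest value that the mean [Q] permits, the
    copies of [T] carry the fraction [2/3 s (1 - u) = (1 - 1/(3 Q)) (1 - u)] of
    the captured weight.  The condition [4 ^ n <= 3 Q] makes [1/(3 Q)] at most
    [u]. *)
Lemma strategy_boost Q c g n T : 1 <= Q -> 4 ^+ n <= 3 * Q -> 0 <= g ->
  strategy Q c g T -> let u : R := (4 ^+ n)^-1 in
  exists T', strategy Q (u + c * (1 - n%:R / 2 * u)) (g * (1 - 2 * u)) T'.
Proof.
move=> Q1 nQ g0 [gT T1 /andP[c0 cc] gg] u.
have u0 : 0 < u by rewrite invr_gt0 exprn_gt0//; lra.
have uE : u * 4 ^+ n = 1 by rewrite mulVf// gt_eqF// exprn_gt0//; lra.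
have mQ : mass T <= Q by have := mass_le Q1 gT; rewrite T1 mulr1.
have Q0 : 0 < Q by lra.
pose v := Q^-1; have vE : v * Q = 1 by rewrite mulVf// gt_eqF.
have v0 : 0 < v by rewrite invr_gt0.
have v1 : v <= 1 by nra.
pose s := 3 / 2 - v / 2.
have s1 : 1 <= s by rewrite /s; lra.
have s0 : 0 <= s by lra.
have sQ : s * mass T <= (3 * Q - 1) / 2.
  apply: (@le_trans _ _ (s * Q)); first by rewrite ler_wpM2l.
  by rewrite /s; nra.
have ud : u * (4 ^+ n - 1) < 3 * 1 by rewrite mulrBr uE; lra.
have vu : v / 3 <= u by nra.
exists (boost s u T n); rewrite /boost; split.
- split; rewrite ?normr0//.
  + rewrite /= !wmin_chain// minxx mulr1.
    have := @mass_chain Q (-1) s T n u 1 Q1 sQ.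
    by have := @mass_chain Q 1 s T n u 1 Q1 sQ; lra.
  + by apply: A1_chain; rewrite ?normrN1.
  + by apply: A1_chain; rewrite ?normr1.
- by rewrite /= !wmin_chain// minxx.
- have /andP[a1 a2] := @cost_chain Q (-1) s T n u 1 (normrN1 _) s0 gT u0 ud.
  have /andP[b1 b2] := @cost_chain Q 1 s T n u 1 (normr1 _) s0 gT u0 ud.
  rewrite /= sub0r add0r -[X in cost X]mulN1r -[X in _ + cost X _]mul1r.
  move: a1 a2 b1 b2.
  set A := cost _ _; set B := cost _ (chain 1 _ _ _ _ _) => a1 a2 b1 b2.
  apply/andP; split; first by lra.
  set N : R := n%:R / 2 * u in a2 b2 *.
  have N0 : 0 <= N by rewrite /N mulr_ge0// ?divr_ge0// ltW.
  have N1 : N <= 1.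
    rewrite /N; have : n%:R <= 4 ^+ n :> R.
      by rewrite -natrX ler_nat; exact/ltnW/ltn_expl.
    by nra.
  suff : s * cost 0 T * (2 / 3 * 1 - N) <= c * (1 - N) by lra.
  apply: (@le_trans _ _ (cost 0 T * (1 - N))); last by rewrite ler_wpM2r//; lra.
  rewrite -mulrA mulrCA ler_pM2l//.
  by rewrite /s; nra.
- have a := @gain_chain Q (-1) s T n u 1 s0 gT u0 ud.
  have b := @gain_chain Q 1 s T n u 1 s0 gT u0 ud.
  rewrite /= subr0 addr0.
  move: a b; rewrite -/u.
  set A := gain _ (chain (-1) _ _ _ _ _); set B := gain _ (chain 1 _ _ _ _ _).
  move=> a b.
  suff : g * (1 - 2 * u) <= 2 / 3 * s * (1 - u) * gain (-1) T by lra.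
  have u1 : u <= 1.
    by rewrite invf_le1 ?exprn_ege1 ?exprn_gt0//; lra.
  apply: (@le_trans _ _ (g * (2 / 3 * s * (1 - u)))).
    by rewrite ler_wpM2l// /s; nra.
  by rewrite mulrC ler_wpM2l// !mulr_ge0//; lra.
Qed.

(** * Iteration *)

(** The half where [phi = z] for a sign [z]: [phi] and [psi] reach 0 together on a
    quarter of the unit interval, where the weight is as large as the mean [Q]
    permits. *)
Definition start_branch Q z : tree := Node z (-1) (Leaf (2 * Q - 1)) (Leaf 1).

Lemma strategy_start Q : 1 <= Q ->
  strategy Q 1 (Q - 2^-1) (Node 1 0 (start_branch Q (-1)) (start_branch Q 1)).
Proof.
move=> Q1; have m1 : Num.min (2 * Q - 1) 1 = 1 :> R by apply/min_idPr; lra.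
split.
- split; rewrite /= ?normr0// ?m1 ?minxx; first by lra.
  + by rewrite ?normrN1; split; lra.
  + by rewrite ?normrN1 ?normr1; split; lra.
- by rewrite /= m1 minxx.
- rewrite /= !sub0r !opprK !add0r addNr subrr normr0 mul0r.
  have -> : `|-1 - 1 : R| = 2 by rewrite -opprD normrN ger0_norm//; lra.
  have -> : `|1 + 1 : R| = 2 by rewrite ger0_norm//; lra.
  by apply/andP; split; lra.
- rewrite /= !subr0 !addr0 opprK addNr lexx.
  case: ifP; lra.
Qed.

Lemma bernoulli_le x (n : nat) : x <= 1 -> 1 - n%:R * x <= (1 - x) ^+ n.
Proof.
move=> x1; elim: n => [|n IHn]; first by rewrite expr0 mul0r subr0.
have n0 : 0 <= n%:R :> R by [].
apply: (@le_trans _ _ ((1 - x) * (1 - n%:R * x))).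
  by rewrite -[n.+1]addn1 natrD; nra.
by rewrite exprS ler_wpM2l//; lra.
Qed.

(** Each new factor [1 - x] absorbs the growth of the other one:
    [(1 - x) (1 + (n + 1) x) <= 1 + n x]. *)
Lemma exprn_decay x (n : nat) : 0 <= x <= 1 ->
  (1 - x) ^+ n * (1 + n%:R * x) <= 1.
Proof.
move=> /andP[x0 x1]; elim: n => [|n IHn]; first by rewrite expr0 mul0r addr0 mulr1.
have n0 : 0 <= n%:R :> R by [].
apply: le_trans IHn; rewrite exprSr -mulrA ler_wpM2l ?exprn_ge0//; first by lra.
by rewrite -[n.+1]addn1 natrD; nra.
Qed.

(** [2 / n] is the fixed point of the cost map [c -> u + c (1 - n u / 2)] and
    [1 - n u / 2] its contraction factor; the start has cost 1. *)
Lemma strategy_iter Q n (k : nat) : 1 <= Q -> 4 ^+ n <= 3 * Q -> (0 < n)%N ->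
  let u : R := (4 ^+ n)^-1 in
  exists T, strategy Q (2 / n%:R + (1 - n%:R / 2 * u) ^+ k)
                     ((Q - 2^-1) * (1 - 2 * u) ^+ k) T.
Proof.
move=> Q1 nQ n0 u.
have n0' : 0 < n%:R :> R by rewrite ltr0n.
have u0 : 0 < u by rewrite invr_gt0 exprn_gt0//; lra.
have u4 : 4 * u <= 1.
  rewrite /u; case: (n) n0 => // m _.
  rewrite exprS invfM mulrA divff ?mul1r ?pnatr_eq0//.
  by rewrite invf_le1 ?exprn_ege1 ?exprn_gt0//; lra.
elim: k => [|k [T IHk]].
  exists (Node 1 0 (start_branch Q (-1)) (start_branch Q 1)).
  have [? ? /andP[? ?] ?] := strategy_start Q1.
  split=> //; rewrite ?expr0 ?mulr1//.
  have : 0 < 2 / n%:R :> R by rewrite divr_gt0.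
  by move=> ?; apply/andP; split; lra.
have g0 : 0 <= (Q - 2^-1) * (1 - 2 * u) ^+ k.
  by rewrite mulr_ge0 ?exprn_ge0//; lra.
have [T' [gT T1 cT gg]] := strategy_boost Q1 nQ g0 IHk.
exists T'; split=> //; last by rewrite exprSr mulrA.
move: cT; rewrite -/u; congr (_ <  _ <= _).
by rewrite exprSr; field; rewrite gt_eqF.
Qed.

(** [1 / u = 4 ^ n] rounds: the excess of the cost over [2 / n] falls to at most
    [1 / (1 + n / 2) <= 2 / n], while the captured weight keeps the factor
    [(1 - 2 u) ^ (1 / u) >= (1 / 2) ^ 4]. *)
Lemma strategy_log Q n : 4 <= Q -> 4 ^+ n <= 3 * Q -> (0 < n)%N ->
  exists T, strategy Q (4 / n%:R) (7 / 128 * Q) T.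
Proof.
move=> Q4 nQ n0; have Q1 : 1 <= Q by lra.
have [T [gT T1 /andP[c0 cT] gg]] := strategy_iter (4 ^ n) Q1 nQ n0.
exists T; split=> //.
  rewrite c0/=; apply: le_trans cT _.
  set u : R := (4 ^+ n)^-1.
  have n0' : 0 < n%:R :> R by rewrite ltr0n.
  have u0 : 0 < u by rewrite invr_gt0 exprn_gt0//; lra.
  have uE : u * 4 ^+ n = 1 by rewrite mulVf// gt_eqF// exprn_gt0//; lra.
  clearbody u.
  have N1 : 0 <= n%:R / 2 * u <= 1.
    rewrite mulr_ge0 ?divr_ge0//= ?ltW//.
    have : n%:R <= 4 ^+ n :> R by rewrite -natrX ler_nat; exact/ltnW/ltn_expl.
    by nra.
  have := exprn_decay (4 ^ n) N1; rewrite natrX.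
  have -> : 4 ^+ n * (n%:R / 2 * u) = n%:R / 2 by rewrite mulrCA [_ * u]mulrC uE mulr1.
  set P := _ ^+ _ => PE.
  suff : P <= 2 / n%:R by lra.
  have P0 : 0 <= P by rewrite exprn_ge0//; case/andP: N1; lra.
  by rewrite ler_pdivlMr//; nra.
apply: le_trans gg; rewrite mulrC.
case: n n0 nQ {T gT T1 c0 cT} => // m _ _.
set u : R := (4 ^+ m.+1)^-1.
have m4 : 0 < 4 ^+ m :> R by rewrite exprn_gt0//; lra.
have uE : u * 4 ^+ m = 4^-1.
  by rewrite /u exprS invfM -mulrA mulVf ?mulr1// gt_eqF.
have u0 : 0 < u by rewrite invr_gt0 exprn_gt0//; lra.
have m1 : 1 <= 4 ^+ m :> R by rewrite exprn_ege1//; lra.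
have /(bernoulli_le (4 ^ m)) : 2 * u <= 1 by nra.
(* [4 ^ m.+1] rounds are four blocks of [4 ^ m], each keeping at least half. *)
rewrite natrX expnSr exprM; set P := (1 - 2 * u) ^+ (4 ^ m) => HP.
have HP' : 2^-1 <= P by apply: le_trans HP; rewrite mulrCA [_ * u]mulrC uE; lra.
have : 2^-1 ^+ 4 <= P ^+ 4 :> R by rewrite lerXn2r ?nnegrE//; lra.
have -> : 2^-1 ^+ 4 = 16^-1 :> R by rewrite exprVn -natrX.
by nra.
Qed.

End Trees.

(** * Means over dyadic intervals and Haar coefficients *)

Section DyadicIntervals.
Context {R : realType}.
Implicit Types (f g w : R -> R) (n k m j : nat) (c v x : R).

Notation mu := (@lebesgue_measure R).

Definition cell n k : set R := `[k%:R / 2 ^+ n, k.+1%:R / 2 ^+ n[.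

(** The reduction modulo [2 ^ n] keeps this total in [k]; it acts as the identity
    on the range [k < 2 ^ n]. *)
Definition dyadic_at n k : dyadic :=
  existT (fun n => 'I_(2 ^ n)) n
    (Ordinal (ltn_pmod k (expn_gt0 2 n : (0 < 2 ^ n)%N))).

Lemma pow2_gt0 n : 0 < 2 ^+ n :> R. Proof. by rewrite exprn_gt0. Qed.

Lemma cellP n k x : cell n k x <-> k%:R <= x * 2 ^+ n < k%:R + 1.
Proof.
rewrite /cell /= in_itv/= ler_pdivrMr ?pow2_gt0// ltr_pdivlMr ?pow2_gt0//.
by rewrite -[k.+1]addn1 natrD.
Qed.

Lemma double_natr k : k.*2%:R = 2 * k%:R :> R.
Proof. by rewrite -mul2n natrM. Qed.

Lemma cell_left n k x : cell n.+1 k.*2 x <->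
  cell n k x /\ x * 2 ^+ n < k%:R + 2^-1.
Proof.
rewrite !cellP double_natr exprS; move: (2 ^+ n) => e.
split=> [/andP[? ?]|[/andP[? ?] ?]]; last by apply/andP; split; lra.
by split; [apply/andP; split|]; lra.
Qed.

Lemma cell_right n k x : cell n.+1 k.*2.+1 x <->
  cell n k x /\ k%:R + 2^-1 <= x * 2 ^+ n.
Proof.
rewrite !cellP -[k.*2.+1]addn1 natrD double_natr exprS; move: (2 ^+ n) => e.
split=> [/andP[? ?]|[/andP[? ?] ?]]; last by apply/andP; split; lra.
by split; [apply/andP; split|]; lra.
Qed.

Lemma cellE n k : cell n k = cell n.+1 k.*2 `|` cell n.+1 k.*2.+1.
Proof.
apply/seteqP; split=> x /=.
  move=> nkx; case: (ltP (x * 2 ^+ n) (k%:R + 2^-1)) => h.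
    by left; apply/cell_left.
  by right; apply/cell_right.
by case=> [/cell_left[]|/cell_right[]].
Qed.

Lemma cell_disj n k : [disjoint cell n.+1 k.*2 & cell n.+1 k.*2.+1].
Proof.
apply/disj_setPS => x [/cell_left[_ h] /cell_right[_ h']].
by move: h; rewrite ltNge h'.
Qed.

Lemma measurable_cell n k : measurable (cell n k).
Proof. exact: measurable_itv. Qed.
Local Hint Extern 0 (measurable (cell _ _)) => exact: measurable_cell : core.

Lemma measure_cell n k : mu (cell n k) = ((2 ^+ n)^-1)%:E.
Proof.
have h : k%:R / 2 ^+ n < k.+1%:R / 2 ^+ n :> R.
  by rewrite ltr_pM2r ?invr_gt0 ?pow2_gt0// ltr_nat.
rewrite /cell lebesgue_measure_itv/= lte_fin h -EFinB -mulrBl.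
by rewrite -[k.+1]addn1 natrD addrAC subrr add0r mul1r.
Qed.

(** Integrability is included because gluing the two halves of a cell needs
    it. *)
Definition mean_on n k f v : Prop :=
  mu.-integrable (cell n k) (EFin \o f) /\
  (\int[mu]_(x in cell n k) (f x)%:E = (v / 2 ^+ n)%:E)%E.

Lemma mean_on_cst n k f v : (forall x, cell n k x -> f x = v) ->
  mean_on n k f v.
Proof.
move=> fv; split.
  apply: (@eq_integrable _ _ _ mu (cell n k) _ (EFin \o cst v)) => //.
    by move=> x /set_mem xA; rewrite /= fv.
  apply/integrableP; split; first by apply/measurable_EFinP; exact: measurable_cst.
  by rewrite (eq_integral (fun=> `|v|%:E))// integral_cst//= measure_cell ltry.
transitivity (\int[mu]_(x in cell n k) v%:E)%E.
  by apply: eq_integral => x /set_mem xA; rewrite fv.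
by rewrite integral_cst//= measure_cell.
Qed.

Lemma mean_on_scale n k f g c v : (forall x, cell n k x -> g x = c * f x) ->
  mean_on n k f v -> mean_on n k g (c * v).
Proof.
move=> gf [fint fv]; split.
  apply: (@eq_integrable _ _ _ mu (cell n k) _ (fun x => c%:E * (f x)%:E)%E) => //.
    by move=> x /set_mem xA; rewrite /= gf.
  exact: (@integrableZl _ _ _ mu (cell n k) (measurable_cell n k)).
transitivity (\int[mu]_(x in cell n k) (c%:E * (f x)%:E))%E.
  by apply: eq_integral => x /set_mem xA; rewrite gf// EFinM.
by rewrite integralZl//= fv -EFinM mulrA.
Qed.

Lemma mean_on_glue n k f v v' : mean_on n.+1 k.*2 f v ->
  mean_on n.+1 k.*2.+1 f v' -> mean_on n k f ((v + v') / 2).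
Proof.
move=> [fint fv] [fint' fv']; rewrite /mean_on cellE.
have mf : measurable_fun (cell n.+1 k.*2 `|` cell n.+1 k.*2.+1) (EFin \o f).
  by apply/measurable_funU => //; split;
    [exact: (measurable_int _ fint)|exact: (measurable_int _ fint')].
split.
  apply/integrableP; split=> //.
  rewrite ge0_integral_setU//; last exact: cell_disj.
    by rewrite lte_add_pinfty//; [case/integrableP: fint|case/integrableP: fint'].
  exact/measurableT_comp.
rewrite integral_setU//; last exact: cell_disj.
have e0 : 2 ^+ n != 0 :> R by rewrite gt_eqF ?pow2_gt0.
rewrite fv fv' -EFinD exprS; congr EFin; by field.
Qed.

Lemma cell_unitI n k : (k < 2 ^ n)%N -> cell n k `<=` @unitI R.
Proof.
move=> kn x /cellP /andP[h1 h2]; rewrite /unitI /= in_itv/=.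
have e0 := pow2_gt0 n; have k0 : 0 <= k%:R :> R by [].
have : k%:R + 1 <= 2 ^+ n :> R by rewrite -natrX -[1]/1%:R -natrD addn1 ler_nat.
by move=> ke; apply/andP; split; nra.
Qed.

Lemma dyadic_left_at n k : (k < 2 ^ n)%N ->
  dyadic_left (dyadic_at n k) = k%:R / 2 ^+ n :> R.
Proof. by move=> kn; rewrite /dyadic_left /= modn_small. Qed.

Lemma dyadic_right_at n k : (k < 2 ^ n)%N ->
  dyadic_right (dyadic_at n k) = k.+1%:R / 2 ^+ n :> R.
Proof.
move=> kn; rewrite /dyadic_right dyadic_left_at// /dyadic_length /=.
by rewrite -[k.+1]addn1 natrD mulrDl mul1r.
Qed.

Lemma dyadic_mid_at n k : (k < 2 ^ n)%N ->
  dyadic_mid (dyadic_at n k) = k.*2.+1%:R / 2 ^+ n.+1 :> R.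
Proof.
move=> kn; rewrite /dyadic_mid dyadic_left_at// /dyadic_length /=.
rewrite -[k.*2.+1]addn1 natrD double_natr exprS; field.
by rewrite gt_eqF ?pow2_gt0.
Qed.

Lemma dyadic_itv_at n k : (k < 2 ^ n)%N ->
  Defs.dyadic_itv (dyadic_at n k) = cell n k.
Proof. by move=> kn; rewrite /Defs.dyadic_itv dyadic_left_at// dyadic_right_at. Qed.

Lemma dyadic_atK (J : dyadic) : dyadic_at (tag J) (tagged J) = J.
Proof.
case: J => n k /=; rewrite /dyadic_at; congr existT; apply: val_inj => /=.
by rewrite modn_small.
Qed.

(** The Haar function of a cell, normalised to take the values -1 and 1. *)
Definition jump n k x : R :=
  \1_(cell n.+1 k.*2.+1) x - \1_(cell n.+1 k.*2) x.

Lemma haar_at n k x : (k < 2 ^ n)%N ->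
  haar (dyadic_at n k) x = Num.sqrt (2 ^+ n) * jump n k x.
Proof.
move=> kn; rewrite /haar dyadic_mid_at// dyadic_left_at//.
rewrite dyadic_right_at// /dyadic_length /= sqrtrV ?invrK ?exprn_ge0//.
rewrite /jump /cell -doubleS.
have h j : j.*2%:R / 2 ^+ n.+1 = j%:R / 2 ^+ n :> R.
  rewrite double_natr exprS; field.
  by rewrite gt_eqF ?pow2_gt0.
by rewrite !h.
Qed.

Lemma jump_left n k x : cell n.+1 k.*2 x -> jump n k x = -1.
Proof.
move=> xl; rewrite /jump !indicE (mem_set xl) memNset ?sub0r// => xr.
by have /disj_setPS/(_ x) := cell_disj n k; apply; split.
Qed.

Lemma jump_right n k x : cell n.+1 k.*2.+1 x -> jump n k x = 1.
Proof.
move=> xr; rewrite /jump !indicE (mem_set xr) memNset ?subr0// => xl.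
by have /disj_setPS/(_ x) := cell_disj n k; apply; split.
Qed.

Lemma jump_off n k x : ~ cell n k x -> jump n k x = 0.
Proof.
rewrite cellE => nx; rewrite /jump !indicE !memNset ?subr0// => h; apply: nx.
  by left.
by right.
Qed.

(** The Haar coefficient sees only the means over the two halves: they are at
    distance [a] from the mean over the whole cell. *)
Lemma haar_coef_at n k f a v : (k < 2 ^ n)%N ->
  mean_on n.+1 k.*2 f (v - a) -> mean_on n.+1 k.*2.+1 f (v + a) ->
  haar_coef f (dyadic_at n k) * Num.sqrt (2 ^+ n) = a.
Proof.
move=> kn fl fr; pose s : R := Num.sqrt (2 ^+ n).
have s2 : s * s = 2 ^+ n by rewrite -expr2 sqr_sqrtr ?exprn_ge0.
have [_ gE] : mean_on n k (fun x => f x * haar (dyadic_at n k) x) (s * a).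
  have -> : s * a = (- s * (v - a) + s * (v + a)) / 2 by field.
  apply: mean_on_glue.
    apply: mean_on_scale fl => x /jump_left h.
    by rewrite haar_at// h mulrN1 mulrN mulNr mulrC.
  apply: mean_on_scale fr => x /jump_right h.
  by rewrite haar_at// h mulr1 mulrC.
suff -> : haar_coef f (dyadic_at n k) = s * a / 2 ^+ n.
  rewrite -/s -s2; field.
  by rewrite gt_eqF// sqrtr_gt0 pow2_gt0.
rewrite /haar_coef /Rintegral -[RHS]/(fine (s * a / 2 ^+ n)%:E) -gE.
rewrite -[in RHS](setIidr (cell_unitI kn)) [in RHS]integral_mkcondr.
congr fine; apply: eq_integral => x _.
rewrite /patch; case: ifPn => //; rewrite notin_setE => /jump_off h.
by rewrite haar_at// h !mulr0.
Qed.

(** A cell has positive measure, so no larger value bounds [w] almost everywhere. *)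
Lemma ess_inf_onE (A : set R) n k w v : (forall x, A x -> v <= w x) ->
  cell n k `<=` A -> (forall x, cell n k x -> w x = v) ->
  ess_inf_on A w = v%:E.
Proof.
move=> vw kA wv; apply/eqP; rewrite eq_le; apply/andP; split; last first.
  apply/ess_infP; apply: nearW => x; rewrite /patch.
  by case: ifPn => [/set_mem/vw|_]; rewrite ?leey// lee_fin.
rewrite leNgt; apply/negP => vlt.
have [N [mN N0 NP]] := ess_inf_le (T:=measurableTypeR R) mu
  (patch (cst +oo%E) A (EFin \o w)).
have kN : cell n k `<=` N.
  move=> x nkx; apply: NP => /=; rewrite /patch mem_set/=; last exact: kA.
  by rewrite wv//; apply/negP; rewrite -ltNge.
have : (mu (cell n k) <= mu N)%E by apply: le_measure => //; exact: mem_set.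
rewrite (_ : mu N = 0%E); last exact: N0.
by rewrite measure_cell lee_fin leNgt invr_gt0 pow2_gt0.
Qed.

Lemma cell00 : cell 0 0 = `[0, 1[%classic.
Proof. by rewrite /cell expr0 mul0r divr1. Qed.

Lemma mean_on_unitI f v : mean_on 0 0 f v ->
  mu.-integrable unitI (EFin \o f) /\
  (\int[mu]_(x in unitI) (f x)%:E = v%:E)%E.
Proof.
rewrite /mean_on cell00 expr0 divr1 => -[fint fv].
have mf := measurable_int _ fint.
have mf1 : measurable_fun unitI (EFin \o f).
  by apply/emeasurable_fun_itv_bndo_bndcP.
rewrite -fv integral_itv_bndo_bndc//; split=> //.
apply/integrableP; split => //; rewrite /unitI.
rewrite -integral_itv_bndo_bndc; last exact: measurableT_comp.
by case/integrableP : fint.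
Qed.

Lemma measure_unitI : mu unitI = 1%E.
Proof. by rewrite /unitI lebesgue_measure_itv/= lte_fin ltr01 sube0. Qed.

End DyadicIntervals.

(** * From trees to admissible triples *)

Section Realisation.
Context {R : realType}.
Implicit Types (f phi psi w : R -> R) (n k m j : nat) (a b c p q v x Q : R).
Implicit Types (t l r : @tree R) (pick : R -> R -> R).

Notation mu := (@lebesgue_measure R).

(** The sum of the moves of a tree placed on the cell [(n, k)]; [pick] selects
    the moves of [phi] or those of [psi]. *)
Fixpoint deviation pick t n k x : R :=
  match t with
  | Leaf _ => 0
  | Node a b l r => pick a b * jump n k x +
      (deviation pick l n.+1 k.*2 x + deviation pick r n.+1 k.*2.+1 x)
  end.

(** Every point outside the cell also receives the value of some leaf, so that
    the weight is positive at the right end point of the unit interval. *)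
Fixpoint weight_of t n k x : R :=
  match t with
  | Leaf w => w
  | Node _ _ l r => if x * 2 ^+ n < k%:R + 2^-1
                    then weight_of l n.+1 k.*2 x
                    else weight_of r n.+1 k.*2.+1 x
  end.

(** [f] starts from the value [p] on the cell [(n, k)] and makes the moves of the
    tree inside it.  In this form the statement passes to subtrees, where
    integrals are computed. *)
Fixpoint follows pick f t p n k : Prop :=
  match t with
  | Leaf _ => forall x, cell n k x -> f x = p
  | Node a b l r => follows pick f l (p - pick a b) n.+1 k.*2 /\
                    follows pick f r (p + pick a b) n.+1 k.*2.+1
  end.

Fixpoint weighted w t n k : Prop :=
  match t with
  | Leaf v => forall x, cell n k x -> w x = v
  | Node _ _ l r => weighted w l n.+1 k.*2 /\ weighted w r n.+1 k.*2.+1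
  end.

Lemma deviation_off pick t n k x : ~ cell n k x -> deviation pick t n k x = 0.
Proof.
elim: t n k => [//|a b l IHl r IHr] n k nx /=.
rewrite jump_off// mulr0 add0r IHl ?IHr ?addr0// => h; apply: nx.
  by case/cell_right: h.
by case/cell_left: h.
Qed.

Lemma follows_deviation pick f t p n k :
  (forall x, cell n k x -> f x = p + deviation pick t n k x) ->
  follows pick f t p n k.
Proof.
elim: t p n k => [v|a b l IHl r IHr] p n k /= fE.
  by move=> x /fE ->; rewrite addr0.
have disj x : cell n.+1 k.*2 x -> cell n.+1 k.*2.+1 x -> False.
  by move=> xl xr; have /disj_setPS/(_ x) := @cell_disj R n k; apply; split.
split; [apply: IHl|apply: IHr] => x nx; rewrite fE.
- rewrite jump_left// (@deviation_off _ r); first by rewrite addr0 mulrN1 addrA.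
  exact: disj nx.
- by rewrite cellE; left.
- rewrite jump_right// (@deviation_off _ l); first by rewrite add0r mulr1 addrA.
  by move=> xl; exact: disj xl nx.
- by rewrite cellE; right.
Qed.

Lemma weighted_weight_of w t n k :
  (forall x, cell n k x -> w x = weight_of t n k x) -> weighted w t n k.
Proof.
elim: t n k => [v|a b l IHl r IHr] n k //= wE.
split; [apply: IHl|apply: IHr] => x.
  by case/cell_left => nx h; rewrite wE// h.
by case/cell_right => nx h; rewrite wE// ltNge h.
Qed.

Lemma weight_of_ge t n k x : wmin t <= weight_of t n k x.
Proof.
elim: t n k => [//|a b l IHl r IHr] n k /=.
by case: ifP => _; rewrite ge_min ?IHl ?IHr ?orbT.
Qed.

Lemma follows_mean pick f t p n k : follows pick f t p n k -> mean_on n k f p.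
Proof.
elim: t p n k => [v|a b l IHl r IHr] p n k /=; first exact: mean_on_cst.
move=> [/IHl fl /IHr fr]; rewrite (_ : p = (p - pick a b + (p + pick a b)) / 2).
  exact: mean_on_glue.
by field.
Qed.

Lemma weighted_mean w t n k : weighted w t n k -> mean_on n k w (mass t).
Proof.
elim: t n k => [v|a b l IHl r IHr] n k /=; first exact: mean_on_cst.
by move=> [/IHl wl /IHr wr]; exact: mean_on_glue.
Qed.

Definition pick_phi a b := a.
Definition pick_psi a b := b.

Lemma cost_mean phi w t p n k : follows pick_phi phi t p n k ->
  weighted w t n k -> mean_on n k (fun x => `|phi x| * w x) (cost p t).
Proof.
elim: t p n k => [v|a b l IHl r IHr] p n k /=.
  by move=> fE wE; apply: mean_on_cst => x nx; rewrite fE// wE.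
move=> [fl fr] [wl wr].
by apply: mean_on_glue; [exact: IHl|exact: IHr].
Qed.

Lemma gain_mean psi w t q n k : follows pick_psi psi t q n k ->
  weighted w t n k ->
  mean_on n k (fun x => if 0 <= psi x then w x else 0) (gain q t).
Proof.
elim: t q n k => [v|a b l IHl r IHr] q n k /=.
  by move=> fE wE; apply: mean_on_cst => x nx; rewrite fE// wE.
move=> [fl fr] [wl wr].
by apply: mean_on_glue; [exact: IHl|exact: IHr].
Qed.

Fixpoint nodes t n k : seq dyadic :=
  match t with
  | Leaf _ => [::]
  | Node _ _ l r => dyadic_at n k :: nodes l n.+1 k.*2 ++ nodes r n.+1 k.*2.+1
  end.

(** Dividing the index of [J] by a power of 2 gives the index of its ancestor at
    level [n]. *)
Definition under_cell n k (J : dyadic) : bool :=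
  (n <= tag J)%N && (tagged J %/ 2 ^ (tag J - n) == k)%N.

Lemma under_cell_half n k (J : dyadic) (s : bool) :
  under_cell n.+1 (s + k.*2) J -> under_cell n k J.
Proof.
move=> /andP[nJ /eqP JE]; apply/andP; split; first exact: ltnW.
by rewrite -(subnSK nJ) expnSr divnMA JE divn2 half_bit_double.
Qed.

Lemma half_lt (s : bool) k n : (k < 2 ^ n -> s + k.*2 < 2 ^ n.+1)%N.
Proof. by move=> kn; rewrite expnS mul2n -ltn_half_double half_bit_double. Qed.

Lemma nodes_under t n k (J : dyadic) : (k < 2 ^ n)%N ->
  J \in nodes t n k -> under_cell n k J.
Proof.
elim: t n k => [//|a b l IHl r IHr] n k kn /=.
rewrite inE mem_cat => /orP[/eqP ->|/orP[/IHl h|/IHr h]].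
- by rewrite /under_cell /= leqnn subnn divn1 modn_small ?eqxx.
- by apply: (@under_cell_half _ _ _ false); exact/h/(half_lt false).
- by apply: (@under_cell_half _ _ _ true); exact/h/(half_lt true).
Qed.

Lemma nodes_uniq t n k : (k < 2 ^ n)%N -> uniq (nodes t n k).
Proof.
elim: t n k => [//|a b l IHl r IHr] n k kn /=.
have ll := half_lt false kn; have rr := half_lt true kn.
rewrite cat_uniq IHl ?IHr//= andbT mem_cat negb_or -andbA; apply/and3P; split.
- by apply/negP => /nodes_under => /(_ ll)/andP[] /=; rewrite ltnn.
- by apply/negP => /nodes_under => /(_ rr)/andP[] /=; rewrite ltnn.
- apply/hasPn => J /nodes_under => /(_ rr) /andP[_ /eqP h]; apply/negP.
  move=> /nodes_under => /(_ ll) /andP[_]; rewrite h => /eqP /(congr1 odd) /=.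
  by rewrite odd_double.
Qed.

Lemma follows_haar_coef pick f a b l r p n k : (k < 2 ^ n)%N ->
  follows pick f (Node a b l r) p n k ->
  haar_coef f (dyadic_at n k) * Num.sqrt (2 ^+ n) = pick a b.
Proof.
by move=> kn [/follows_mean fl /follows_mean fr]; exact: haar_coef_at fl fr.
Qed.

Lemma deviation_haar pick f t p n k x : (k < 2 ^ n)%N ->
  follows pick f t p n k ->
  deviation pick t n k x = \sum_(J <- nodes t n k) haar_coef f J * haar J x.
Proof.
elim: t p n k => [v|a b l IHl r IHr] p n k kn /=; first by rewrite big_nil.
move=> fE; have := follows_haar_coef kn fE; case: fE => fl fr <-.
rewrite big_cons big_cat/= haar_at// mulrA; congr (_ + (_ + _)).
  exact: IHl (half_lt false kn) fl.
exact: IHr (half_lt true kn) fr.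
Qed.

(** The multipliers [eps] are recovered as quotients of Haar coefficients,
    which are bounded by 1 because each move has [|b| <= |a|]. *)
Lemma node_coef_le Q phi psi t p q n k (J : dyadic) : (k < 2 ^ n)%N ->
  A1_tree Q t ->
  follows pick_phi phi t p n k -> follows pick_psi psi t q n k ->
  J \in nodes t n k -> `|haar_coef psi J| <= `|haar_coef phi J|.
Proof.
elim: t p q n k => [//|a b l IHl r IHr] p q n k kn [ba _ gl gr] fphi fpsi.
rewrite /= inE mem_cat => /orP[/eqP ->|/orP[]].
- have s0 : 0 < Num.sqrt (2 ^+ n) :> R by rewrite sqrtr_gt0 pow2_gt0.
  have nE c : `|c| * Num.sqrt (2 ^+ n) = `|c * Num.sqrt (2 ^+ n)|.
    by rewrite normrM (gtr0_norm s0).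
  rewrite -(ler_pM2r s0) !nE.
  by rewrite (follows_haar_coef kn fphi) (follows_haar_coef kn fpsi).
- case: fphi fpsi => [f1 _] [f2 _]; exact: IHl (half_lt false kn) gl f1 f2.
- case: fphi fpsi => [_ f1] [_ f2]; exact: IHr (half_lt true kn) gr f1 f2.
Qed.

Lemma martingale_pair_tree Q t p q : A1_tree Q t ->
  martingale_pair p q (fun x => p + deviation pick_phi t 0 0 x)
                      (fun x => q + deviation pick_psi t 0 0 x).
Proof.
move=> gt; set phi := fun x => p + _; set psi := fun x => q + _.
have fphi : follows pick_phi phi t p 0 0 by exact: follows_deviation.
have fpsi : follows pick_psi psi t q 0 0 by exact: follows_deviation.
pose F : {fset dyadic} := [fset J in nodes t 0 0]%fset.
(* Off the nodes the quotient may exceed 1, hence the default value 0. *)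
pose eps J : R := if `|haar_coef psi J| <= `|haar_coef phi J|
                  then haar_coef psi J / haar_coef phi J else 0.
have FE (h : dyadic -> R) : \sum_(J <- F) h J = \sum_(J <- nodes t 0 0) h J.
  apply: perm_big; apply: uniq_perm => [||J]; [exact: fset_uniq|exact: nodes_uniq|].
  by rewrite !inE.
exists F, eps; split.
- move=> J; rewrite /eps; case: ifP => [h|_]; last by rewrite normr0.
  rewrite normrM normfV; have [->|c0] := eqVneq (haar_coef phi J) 0.
    by rewrite normr0 invr0 mulr0.
  by rewrite ler_pdivrMr ?normr_gt0// mul1r.
- by move=> x _; rewrite FE -(deviation_haar x _ fphi).
- move=> x _; rewrite FE /psi; congr (_ + _).
  rewrite (deviation_haar x _ fpsi)// big_seq [RHS]big_seq.
  apply: eq_bigr => J Jt; congr (_ * _); rewrite /eps.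
  have h : `|haar_coef psi J| <= `|haar_coef phi J|.
    by apply: node_coef_le gt fphi fpsi Jt; rewrite expn_gt0.
  rewrite h.
  have [c0|c0] := eqVneq (haar_coef phi J) 0; last by rewrite divfK.
  by move: h; rewrite c0 normr0 normr_le0 => /eqP ->; rewrite mulr0.
Qed.

Lemma cell_sub n m j (k := (j %/ 2 ^ m)%N) : cell (n + m) j `<=` @cell R n k.
Proof.
elim: m j @k => [|m IHm] j /=; first by rewrite expn0 divn1 addn0.
rewrite addnS expnS divnMA divn2 => x xj; apply: IHm.
have := odd_double_half j; case: (odd j) => /= jE; move: xj; rewrite -{1}jE.
  by case/cell_right.
by case/cell_left.
Qed.

Lemma weighted_wmin Q w t n k : A1_tree Q t -> weighted w t n k ->
  (forall x, cell n k x -> wmin t <= w x) /\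
  exists n' k', cell n' k' `<=` @cell R n k /\
    forall x, cell n' k' x -> w x = wmin t.
Proof.
elim: t n k => [v|a b l IHl r IHr] n k.
  move=> _ wE; split; first by move=> x /wE ->.
  by exists n, k; split=> // x /wE.
move=> [_ _ gl gr] [/(IHl _ _ gl) [lel [n1 [k1 [s1 E1]]]]].
move=> /(IHr _ _ gr) [ler [n2 [k2 [s2 E2]]]]; split.
  move=> x; rewrite cellE => -[/lel|/ler] h /=; rewrite ge_min h ?orbT//.
rewrite /= cellE; case: leP => _.
  by exists n1, k1; split=> // x /s1; left.
by exists n2, k2; split=> // x /s2; right.
Qed.

(** A dyadic interval inside the cell of a tree is the cell itself, lies in one of
    its halves, or lies below a leaf, where the weight is constant. *)
Lemma weighted_A1 Q w t n m j : 1 <= Q -> A1_tree Q t ->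
  weighted w t n (j %/ 2 ^ m)%N ->
  exists M v, [/\ mean_on (n + m) j w M, 0 < v, M <= Q * v &
    ess_inf_on (cell (n + m) j) w = v%:E].
Proof.
move=> Q1; elim: t n m j => [v|a b l IHl r IHr] n m j.
  move=> v0 wE; exists v, v.
  have wE' x : cell (n + m) j x -> w x = v by move=> /cell_sub /wE.
  split=> //; [exact: mean_on_cst|by rewrite ler_peMl// ltW|].
  by apply: (@ess_inf_onE _ _ (n + m) j) => // x /wE' ->.
case: m => [gt wt|m gt [wl wr]].
  rewrite addn0; move: wt; rewrite expn0 divn1 => wt.
  have [lew [n' [k' [s' E']]]] := weighted_wmin gt wt.
  exists (mass (Node a b l r)), (wmin (Node a b l r)); split.
  - exact: weighted_mean.
  - exact: wmin_gt0 gt.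
  - by case: gt.
  - exact: ess_inf_onE lew s' E'.
case: gt => _ _ gl gr; rewrite -addSnnS.
have := odd_double_half (j %/ 2 ^ m)%N.
rewrite -divn2 -divnMA -expnSr; case: (odd _) => /= jE.
  by apply: IHr => //; rewrite -jE.
by apply: IHl => //; rewrite -jE.
Qed.

Lemma average_mean n k f v : mean_on n k f v -> average f (cell n k) = v%:E.
Proof.
move=> [_ fv]; rewrite /average fv measure_cell inver.
have e0 : 2 ^+ n != 0 :> R by rewrite gt_eqF ?pow2_gt0.
by rewrite (negbTE (invr_neq0 e0)) invrK -EFinM divfK.
Qed.

Lemma A1_char_weighted Q w t : 1 <= Q -> A1_tree Q t -> weighted w t 0 0 ->
  (A1_char w <= Q%:E)%E.
Proof.
move=> Q1 gt wt; apply: ge_ereal_sup => _ [J _ <-].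
rewrite -(dyadic_atK J); case: J => n k /=.
have w0 : weighted w t 0 (k %/ 2 ^ n)%N by rewrite divn_small.
have [M [v [Mw v0 MQ vE]]] := weighted_A1 Q1 gt w0.
rewrite dyadic_itv_at// vE (average_mean Mw) inver (gt_eqF v0) -EFinM.
by rewrite lee_fin ler_pdivrMr.
Qed.

Lemma tree_admissible Q t : 1 <= Q -> A1_tree Q t -> wmin t = 1 ->
  exists phi psi w, admissible Q (0, -1, cost 0 t, mass t, 1) phi psi w /\
    (wmeasure w (unitI `&` [set x | (0 <= psi x)%R]) / mu unitI)%E
      = (gain (-1) t)%:E.
Proof.
move=> Q1 gt t1.
pose phi x := 0 + deviation pick_phi t 0 0 x.
pose psi x := -1 + deviation pick_psi t 0 0 x.
pose w := weight_of t 0 0.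
have fphi : follows pick_phi phi t 0 0 0 by exact: follows_deviation.
have fpsi : follows pick_psi psi t (-1) 0 0 by exact: follows_deviation.
have wt : weighted w t 0 0 by exact: weighted_weight_of.
have div1 (y : \bar R) : (y / mu unitI)%E = y.
  by rewrite measure_unitI inver oner_eq0 invr1 mule1.
have [wint wE] := mean_on_unitI (weighted_mean wt).
exists phi, psi, w; split; first split.
- exact: martingale_pair_tree gt.
- split; last exact: A1_char_weighted wt.
  split=> // x _; apply: lt_le_trans (weight_of_ge t 0 0 x).
  by rewrite t1.
- by rewrite /average div1; case: (mean_on_unitI (cost_mean fphi wt)).
- by rewrite /average div1.
- have [_ [n [k [nk wnk]]]] := weighted_wmin gt wt.
  rewrite -t1; apply: (@ess_inf_onE _ _ n k) => // [x _|x /nk].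
    exact: weight_of_ge.
  exact: cell_unitI.
- rewrite div1 /wmeasure integral_mkcondr.
  have [_ <-] := mean_on_unitI (gain_mean fpsi wt).
  apply: eq_integral => x _; rewrite /patch.
  by case: ifPn => [/set_mem /= ->//|]; rewrite notin_setE /= => /negP/negbTE ->.
Qed.

Lemma bellmanG_ge Q c g t : 1 <= Q -> strategy Q c g t ->
  exists x3 x4 : R, [/\ G Q (0, x3, x4), 0 < x3 <= c &
    (g%:E <= bellmanG Q (0%R, x3, x4))%E].
Proof.
move=> Q1 [gt t1 /andP[c0 cc] gg]; exists (cost 0 t), (mass t); split.
- split; first by rewrite normr0 ltW.
    by rewrite -t1 wmin_le_mass.
  by have := mass_le Q1 gt; rewrite t1 mulr1.
- by rewrite c0.
have [phi [psi [w [adm E]]]] := tree_admissible Q1 gt t1.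
apply: (@le_trans _ _ (gain (-1) t)%:E); first by rewrite lee_fin.
by apply: ereal_sup_ubound; exists phi, psi, w; rewrite E.
Qed.

End Realisation.

(** * The choice of the number of levels *)

(** For [n >= 2], [ln Q >= n ^ 3 >= 4 n] and [exp 4 >= 5]; for [n = 1] the
    claim is the hypothesis on [Q]. *)
Lemma pow4_le (R : realType) (Q : R) (n : nat) : 4 <= Q -> (0 < n)%N ->
  (n%:R ^+ 3 <= ln Q)%R -> 4 ^+ n <= Q.
Proof.
move=> Q4 n0 nQ; case: n n0 nQ => // -[|n] _ nQ; first by rewrite expr1.
have Q0 : 0 < Q by lra.
rewrite -(lnK (Q0 : Q \is Num.pos)).
have n4 : n.+2%:R * 4 <= ln Q.
  apply: le_trans nQ; rewrite exprS ler_pM2l//.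
  have : 2 <= n.+2%:R :> R by rewrite ler_nat.
  by nra.
apply: (@le_trans _ _ (expR (n.+2%:R * 4))); last by rewrite ler_expR.
rewrite expRM_natl lerXn2r ?nnegrE ?expR_ge0//.
by have := expR_ge1Dx (4 : R); lra.
Qed.

Unset Implicit Arguments.
Set Strict Implicit.

Theorem theorem3p2 (R : realType) (Q : R) (hQ : 4 <= Q) :
  exists x1 x3 x4 : R,
    [/\ G Q (x1, x3, x4), 0 < x3 &
      ((515%:R^-1 * Q * (ln Q `^ (3%:R^-1)) * x3)%:E
         <= bellmanG Q (x1, x3, x4))%E].
Proof.
have Q1 : 1 <= Q by lra.
have lnQ0 : 0 <= ln Q by rewrite ln_ge0.
pose L := ln Q `^ (3%:R^-1); have L0 : 0 <= L by exact: powR_ge0.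
have L3 : L ^+ 3 = ln Q.
  by rewrite -powR_mulrn// -powRrM mulVf// powRr1.
pose n := maxn 1 (Num.truncn L); have n0 : (0 < n)%N by rewrite leq_max.
have Ln : L <= 2 * n%:R.
  have /andP[_ h] := truncn_itv L0.
  apply: (le_trans (ltW h)); rewrite -natrM ler_nat /n.
  case: (Num.truncn L) => [//|k].
  by rewrite (maxn_idPr _)// mul2n -addnn addSn addnS !ltnS leq_addr.
(* If [L < 2] then [n = 1]; otherwise [n ^ 3 <= L ^ 3 = ln Q]. *)
have nQ : 4 ^+ n <= Q.
  rewrite /n; case: (leqP (Num.truncn L) 1) => h; first by rewrite expr1.
  apply: pow4_le => //; first exact: ltnW.
  by rewrite -L3 lerXn2r ?nnegrE//; case/andP: (truncn_itv L0).
clearbody n; have nQ3 : 4 ^+ n <= 3 * Q by lra.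
have [T HT] := strategy_log hQ nQ3 n0.
have [x3 [x4 [Gx /andP[x30 x3n] B]]] := bellmanG_ge Q1 HT.
exists 0, x3, x4; split=> //; apply: le_trans B; rewrite lee_fin -/L.
have n0' : 0 < n%:R :> R by rewrite ltr0n.
have Lx : L * x3 <= 8.
  apply: (@le_trans _ _ (2 * n%:R * (4 / n%:R))).
    by apply: ler_pM => //; exact: ltW.
  rewrite (_ : _ * _ = 8)//; field; exact: lt0r_neq0.
by nra.
Qed.
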